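(* If $\tau=1010$ or $\tau=1120$, then $$f_\tau(x)=\frac{(1-x)(1-5x+7x^2-x^3)}{(1-2x)^2(1-3x+x^2)}$$ as formal power series in $x$, where $f_\tau(x)=\sum_{n\ge 0} b_n(\tau)x^n$ and $b_n(\tau)$ is the number of ascent sequences of length $n$ that avoid both patterns $021$ and $\tau$.
   Context: For a finite sequence $w=w_1\cdots w_n$ of integers, $\mathrm{asc}(w)$ is the number of indices $1\le i\le n-1$ with $w_i<w_{i+1}$. An ascent sequence of length $n\ge 1$ is a sequence $a_1\cdots a_n$ of non-negative integers such that $a_1=0$ and $a_i\le \mathrm{asc}(a_1\cdots a_{i-1})+1$ for $1<i\le n$; there is exactly one (empty) ascent sequence of length $0$. A sequence $\pi=\pi_1\cdots\pi_n$ contains a pattern $\tau=\tau_1\cdots\tau_m$ if there are indices $1\le i_1<\cdots<i_m\le n$ such that for all $j,k\in\{1,\dots,m\}$: $\pi_{i_j}<\pi_{i_k}$ iff $\tau_j<\tau_k$, and $\pi_{i_j}=\pi_{i_k}$ iff $\tau_j=\tau_k$; otherwise $\pi$ avoids $\tau$. For a pattern $\tau$, $B_n(\tau)$ is the set of ascent sequences of length $n$ avoiding both $021$ and $\tau$ (with $B_0(\tau)$ consisting of the empty sequence), and $b_n(\tau)=|B_n(\tau)|$. *)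

(* Defs.v *)
From mathcomp Require Import all_boot all_order all_algebra.

Set Implicit Arguments.
Unset Strict Implicit.
Unset Printing Implicit Defensive.

Import GRing.Theory.
Local Open Scope nat_scope.

(* Sequences are lists of naturals, so that the i-th term (counting from 1)
   is [nth 0 w i.-1]. *)

Definition asc (w : seq nat) : nat :=
  #|[set i : 'I_(size w).-1 | nth 0 w i < nth 0 w i.+1]|.

Definition ascent_seq (a : seq nat) : bool :=
  [forall i : 'I_(size a),
     if i == 0 :> nat then nth 0 a i == 0
     else nth 0 a i <= (asc (take i a)).+1].

Definition contains (pi tau : seq nat) : bool :=
  [exists f : {ffun 'I_(size tau) -> 'I_(size pi)},
     [forall j : 'I_(size tau), forall k : 'I_(size tau),
        [&& (j < k) ==> (f j < f k),
            (nth 0 pi (f j) < nth 0 pi (f k)) == (nth 0 tau j < nth 0 tau k)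
          & (nth 0 pi (f j) == nth 0 pi (f k)) == (nth 0 tau j == nth 0 tau k)]]].

Definition avoids (pi tau : seq nat) : bool := ~~ contains pi tau.

(* Every term of an ascent sequence is smaller than its length, so ascent
   sequences of length n can be enumerated as n-tuples over 'I_n. *)
Lemma ascent_seq_lt (a : seq nat) (i : nat) :
  ascent_seq a -> i < size a -> nth 0 a i < size a.
Proof.
move=> /forallP Ha lti; have /= := Ha (Ordinal lti).
case: eqP => [_ /eqP -> | /eqP i0 le_i]; first exact: leq_ltn_trans lti.
apply: leq_ltn_trans le_i _.
have le_asc : asc (take i a) <= i.-1.
  by apply: leq_trans (max_card _) _; rewrite card_ord size_takel // ltnW.
apply: leq_ltn_trans lti; apply: leq_ltn_trans le_asc _.
by rewrite ltn_predL lt0n.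
Qed.

Definition Bset (tau : seq nat) (n : nat) : {set n.-tuple 'I_n} :=
  [set t : n.-tuple 'I_n |
    let a := [seq val i | i <- t] in
    [&& ascent_seq a, avoids a [:: 0; 2; 1] & avoids a tau]].

Definition bnum (tau : seq nat) (n : nat) : nat := #|Bset tau n|.

Lemma ascent_seq_tuple (a : seq nat) (n : nat) :
  ascent_seq a -> size a = n ->
  exists t : n.-tuple 'I_n, [seq val i | i <- t] = a.
Proof.
move=> Ha <-.
exists [tuple Ordinal (ascent_seq_lt Ha (ltn_ord i)) | i < size a].
apply: (@eq_from_nth _ 0) => [|i]; rewrite size_map size_tuple // => lti.
rewrite (nth_map (Ordinal lti)) ?size_tuple //.
by rewrite -[i]/(val (Ordinal lti)) -tnth_nth tnth_mktuple.
Qed.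

Local Open Scope ring_scope.

(* Formal power series over a field, given by their coefficients. *)
Definition fps (F : fieldType) : Type := nat -> F.

Definition fps_of_poly (F : fieldType) (p : {poly F}) : fps F := fun n => p`_n.

Definition fps_mul (F : fieldType) (u v : fps F) : fps F :=
  fun n => \sum_(i < n.+1) u i * v (n - i)%N.

(* The first n coefficients of 1 / u: the coefficient c_n is determined by
   u_0 c_n + \sum_(i < n) u_(n - i) c_i = [n = 0]. *)
Fixpoint fps_inv_seq (F : fieldType) (u : fps F) (n : nat) : seq F :=
  if n is m.+1 then
    let c := fps_inv_seq u m in
    rcons c ((u 0)^-1 * ((m == 0)%:R - \sum_(i < m) u (m - i)%N * c`_i))
  else [::].

(* The inverse of u when u 0 != 0, and the zero series otherwise. *)
Definition fps_inv (F : fieldType) (u : fps F) : fps F :=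
  fun n => (fps_inv_seq u n.+1)`_n.

Definition fps_div (F : fieldType) (u v : fps F) : fps F :=
  fps_mul u (fps_inv v).

Lemma size_fps_inv_seq (F : fieldType) (u : fps F) (n : nat) :
  size (fps_inv_seq u n) = n.
Proof. by elim: n => //= n IHn; rewrite size_rcons IHn. Qed.

Lemma nth_fps_inv_seq (F : fieldType) (u : fps F) (n i : nat) :
  (i < n)%N -> (fps_inv_seq u n)`_i = fps_inv u i.
Proof.
elim: n => // n IHn; rewrite ltnS leq_eqVlt => /predU1P[-> // | lti].
by rewrite /= nth_rcons size_fps_inv_seq lti IHn.
Qed.

Lemma fps_invE (F : fieldType) (u : fps F) (n : nat) :
  fps_inv u n =
    (u 0)^-1 * ((n == 0)%:R - \sum_(i < n) u (n - i)%N * fps_inv u i).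
Proof.
rewrite {1}/fps_inv /= nth_rcons size_fps_inv_seq ltnn eqxx.
by under eq_bigr => i _ do rewrite nth_fps_inv_seq //.
Qed.

Lemma fps_mulVf (F : fieldType) (u : fps F) :
  u 0 != 0 -> fps_mul (fps_inv u) u =1 fps_of_poly 1.
Proof.
move=> u0 n; rewrite /fps_mul /fps_of_poly coef1 big_ord_recr /= subnn.
rewrite [fps_inv u n]fps_invE mulrAC mulVf // mul1r addrC.
by rewrite [X in _ + X](eq_bigr (fun i : 'I_n => u (n - i)%N * fps_inv u i))
  ?subrK // => i _; rewrite mulrC.
Qed.

Definition gf (tau : seq nat) : fps rat := fun n => (bnum tau n)%:R.

(* Main.v *)
(** Since an ascent sequence starts with 0, it avoids 021 iff its nonzero terms
    are weakly increasing.  Let m be the maximum and s = asc - m the slack.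
    A next term is then 0, or m (raising s by 1 if the last term is 0), or
    larger, leaving any slack between 0 and s.  Both patterns end in a term that
    is not their maximum, so only appending 0 can create one.  For 1010 this
    happens once some x 0 x with x > 0 has occurred, for 1120 once some x x z with
    0 < x < z has occurred; before that the slack stays bounded (1010), or is
    unbounded but enters the counts P through P_(s+1) (1-2x) = P_s (1-x) (1120).
    Either way the numbers are part of a finite linear system, and both systems
    satisfy the recurrence given by the denominator. *)

Require Import Defs.
From mathcomp Require Import all_boot all_order all_algebra.
From mathcomp Require Import zify ring lra.
Import GRing.Theory.

Set Implicit Arguments.
Unset Strict Implicit.
Unset Printing Implicit Defensive.

Local Open Scope nat_scope.

(** * Pattern containment and ascent sequences under appending a term *)

(* Comparing equalities as well would be redundant: [a = b] iff neither
   [a < b] nor [b < a]. *)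
Definition same_order (u v : seq nat) : bool :=
  (size u == size v) &&
  all (fun j => all (fun k =>
    (nth 0 u j < nth 0 u k) == (nth 0 v j < nth 0 v k)) (iota 0 (size v)))
    (iota 0 (size v)).

Lemma same_orderP (u v : seq nat) :
  reflect (size u = size v /\ forall j k, j < size v -> k < size v ->
             (nth 0 u j < nth 0 u k) = (nth 0 v j < nth 0 v k))
          (same_order u v).
Proof.
apply: (iffP andP) => -[size_uv uv].
- split=> [|j k ltj ltk]; first exact/eqP.
  have /allP/(_ k) : all (fun k => (nth 0 u j < nth 0 u k) ==
      (nth 0 v j < nth 0 v k)) (iota 0 (size v)).
    by apply: (allP uv); rewrite mem_iota.
  by rewrite mem_iota => /(_ ltk)/eqP.
- split; first exact/eqP.
  apply/allP=> j /[!mem_iota] /= ltj; apply/allP=> k /[!mem_iota] /= ltk.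
  by apply/eqP/uv.
Qed.

(** An increasing choice of positions amounts to a mask, so containment becomes a matter of
    [subseq], which is easy to follow when a term is appended. *)
Lemma containsP (pi tau : seq nat) :
  reflect (exists2 u, subseq u pi & same_order u tau) (contains pi tau).
Proof.
apply: (iffP existsP) => [[f /forallP f_ok] | [_ /subseqP[m size_m ->]]].
- pose g := [seq val i | i <- codom f].
  have size_g : size g = size tau by rewrite size_map size_codom card_ord.
  have nth_g (j : 'I_(size tau)) : nth 0 g j = f j.
    have j_cod : j < size (codom f) by rewrite size_codom card_ord.
    by rewrite (nth_map (f j)) // (nth_map j) ?size_enum_ord // nth_ord_enum.
  have sorted_g : sorted ltn g.
    apply/(sortedP 0) => i /[!size_g] lti; have lti' := ltnW lti.
    have /forallP/(_ (Ordinal lti))/and3P[/implyP lt_f _ _] := f_ok (Ordinal lti').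
    by rewrite (nth_g (Ordinal lti')) (nth_g (Ordinal lti)); apply: lt_f => /=.
  exists [seq nth 0 pi i | i <- g].
    rewrite -{2}[pi](mkseq_nth 0) /mkseq; apply: map_subseq.
    suff -> : g = [seq i <- iota 0 (size pi) | i \in g] by apply: filter_subseq.
    apply: (irr_sorted_eq ltn_trans ltnn) => //.
      by apply: sorted_filter (iota_ltn_sorted _ _); apply: ltn_trans.
    move=> i; rewrite mem_filter mem_iota /=; apply/idP/andP=> [gi|[]//]; split=> //.
    by have /mapP[j _ ->] := gi; rewrite ltn_ord.
  apply/same_orderP; split=> [|j k ltj ltk]; first by rewrite size_map.
  rewrite !(nth_map 0) ?size_g // (nth_g (Ordinal ltj)) (nth_g (Ordinal ltk)).
  by have /forallP/(_ (Ordinal ltk))/and3P[_ /eqP -> _] := f_ok (Ordinal ltj).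
- set h := mask m (iota 0 (size pi)).
  have -> : mask m pi = [seq nth 0 pi i | i <- h].
    by rewrite map_mask -/(mkseq _ _) mkseq_nth.
  move=> /same_orderP[]; rewrite size_map => size_h h_order.
  have lt_h i : i < size tau -> nth 0 h i < size pi.
    rewrite -size_h => /(mem_nth 0)/mem_mask.
    by rewrite mem_iota.
  exists [ffun j => Ordinal (lt_h _ (ltn_ord j))].
  have lt_nth j k : j < size tau -> k < size tau ->
      (nth 0 pi (nth 0 h j) < nth 0 pi (nth 0 h k)) = (nth 0 tau j < nth 0 tau k).
    by move=> ltj ltk; rewrite -h_order // !(nth_map 0) ?size_h.
  apply/forallP=> j; apply/forallP=> k; rewrite !ffunE /=.
  apply/and3P; split; first 1 last.
  + by rewrite lt_nth.
  + have eq_lt a b : (a == b) = ~~ (a < b) && ~~ (b < a).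
      by rewrite -!leqNgt eqn_leq andbC.
    by rewrite (eq_lt (nth 0 pi _)) (eq_lt (nth 0 tau _)) !lt_nth.
  apply/implyP=> ltjk.
  have : sorted ltn h.
    by apply: sorted_mask (iota_ltn_sorted _ _); apply: ltn_trans.
  by move/(sorted_ltn_nth ltn_trans 0); apply; rewrite ?inE ?size_h.
Qed.

Lemma subseq_rcons_rcons (T : eqType) (u w : seq T) (z y : T) :
  subseq (rcons u z) (rcons w y) =
    subseq (rcons u z) w || (z == y) && subseq u w.
Proof.
rewrite -(subseq_rev _ (rcons w y)) -(subseq_rev (rcons u z) w) -(subseq_rev u).
rewrite !rev_rcons /=.
case: eqVneq => [_|_]; rewrite ?orbF //.
by apply/esym/orb_idl => /cons_subseq.
Qed.

Lemma contains_rcons (w tau : seq nat) (y : nat) :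
  contains w tau -> contains (rcons w y) tau.
Proof.
case/containsP=> u uw u_tau; apply/containsP; exists u => //.
exact: subseq_trans uw (subseq_rcons _ _).
Qed.

(** A new occurrence would end at [y], a maximum of the extended word, whereas the last letter of
    [tau] is exceeded by an earlier one. *)
Lemma contains_rcons_max (w tau : seq nat) (y : nat) :
  all (leq^~ y) w -> has (ltn (last 0 tau)) tau ->
  contains (rcons w y) tau -> contains w tau.
Proof.
move=> /allP w_le_y; elim/last_ind: tau => // t a _ /=.
rewrite last_rcons => /hasP[b b_in /= ltab].
have bt : b \in t.
  by move: b_in; rewrite mem_rcons inE => /predU1P[eq_ab|//]; rewrite eq_ab ltnn in ltab.
case/containsP=> u; elim/last_ind: u => [|u z _] sub_u.
  by case/same_orderP; rewrite size_rcons.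
move=> order_u; move: sub_u; rewrite subseq_rcons_rcons => /orP[?|/andP[/eqP zy uw]].
  by apply/containsP; exists (rcons u z).
have [/eqP] := same_orderP _ _ order_u.
rewrite !size_rcons eqSS => /eqP size_u /(_ (size t) (index b t)).
rewrite !nth_rcons ltnn eqxx size_u.
rewrite ltnS leqnn ltnS index_size ltnn eqxx index_mem bt nth_index //.
rewrite ltab => /(_ isT isT) lt_z.
suff /w_le_y : nth 0 u (index b t) \in w by rewrite leqNgt -zy lt_z.
by apply: (mem_subseq uw); rewrite mem_nth // size_u index_mem.
Qed.

(** For empty [w] the default in [last 0 w] would produce a false ascent whenever [y] is
    positive. *)
Lemma asc_rcons (w : seq nat) (y : nat) :
  w != [::] -> asc (rcons w y) = asc w + (last 0 w < y).
Proof.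
have ascE v : asc v = \sum_(i < (size v).-1) (nth 0 v i < nth 0 v i.+1).
  rewrite /asc -sum1_card big_mkcond; apply: eq_bigr => i _.
  by rewrite inE; case: ifP.
case/lastP: w => // w x _; rewrite !ascE !size_rcons big_ord_recr /=.
rewrite !nth_rcons !size_rcons ltnn eqxx ltnSn ltnn eqxx last_rcons.
congr (_ + _); apply: eq_bigr => i _.
rewrite [in LHS]nth_rcons [in X in _ < X]nth_rcons size_rcons !ltnS.
by rewrite (ltnW (ltn_ord i)) ltn_ord.
Qed.

Lemma ascent_seqP (a : seq nat) :
  reflect (forall i, i < size a -> if i == 0 then nth 0 a i == 0
             else nth 0 a i <= (asc (take i a)).+1) (ascent_seq a).
Proof.
apply: (iffP forallP) => [a_ok i lti | a_ok i]; last exact: a_ok.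
exact: (a_ok (Ordinal lti)).
Qed.

Lemma ascent_seq_rcons (w : seq nat) (y : nat) :
  w != [::] -> ascent_seq (rcons w y) = ascent_seq w && (y <= (asc w).+1).
Proof.
move=> w0; have size_w : size w != 0 by rewrite size_eq0.
apply/ascent_seqP/andP=> [wy_ok | [/ascent_seqP w_ok le_y] i].
  split; last first.
    have := wy_ok (size w); rewrite size_rcons ltnSn nth_rcons ltnn eqxx.
    by rewrite (negPf size_w) -cats1 take_size_cat //; apply.
  apply/ascent_seqP => i lti; have := wy_ok i.
  have lei := ltnW lti.
  by rewrite size_rcons ltnS nth_rcons lti lei -cats1 takel_cat //; apply.
rewrite size_rcons ltnS nth_rcons => le_i.
case: ltngtP le_i => // [lti _|-> _].
  by rewrite -cats1 takel_cat ?(ltnW lti) //; apply: w_ok.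
by rewrite (negPf size_w) -cats1 take_size_cat.
Qed.

(** * Counting the valid continuations of a prefix *)

Definition valid (tau w : seq nat) : bool :=
  [&& ascent_seq w, avoids w [:: 0; 2; 1] & avoids w tau].

Lemma avoids_longer (w tau : seq nat) : size w < size tau -> avoids w tau.
Proof.
move=> lt_size; apply/containsP=> -[u /size_subseq le_u /same_orderP[size_u _]].
by rewrite -size_u ltnNge le_u in lt_size.
Qed.

Lemma valid_rcons (tau w : seq nat) (y : nat) :
  size tau > 0 -> valid tau (rcons w y) -> valid tau w.
Proof.
move=> tau0 /and3P[asc_w a1 a2].
have [-> | w0] := eqVneq w [::].
  by rewrite /valid !avoids_longer // !andbT; apply/ascent_seqP.
apply/and3P; split.
- by move: asc_w; rewrite ascent_seq_rcons // => /andP[].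
- by apply: contraNN a1; apply: contains_rcons.
- by apply: contraNN a2; apply: contains_rcons.
Qed.

(* For [N] large enough, the bound on the entries is no restriction. *)
Definition extensions (tau : seq nat) (N n : nat) (w : seq nat) : nat :=
  #|[set t : n.-tuple 'I_N | valid tau (w ++ [seq val i | i <- t])]|.

Lemma extensions0 (tau : seq nat) (N : nat) (w : seq nat) :
  extensions tau N 0 w = valid tau w.
Proof.
rewrite /extensions -sum1_card big_mkcond /= (big_pred1 [tuple]).
  by rewrite inE /= cats0; case: ifP.
by move=> t; apply/esym/eqP/tuple0.
Qed.

Lemma extensionsS (tau : seq nat) (N n : nat) (w : seq nat) :
  extensions tau N n.+1 w = \sum_(i < N) extensions tau N n (rcons w i).
Proof.
rewrite /extensions -sum1_card (partition_big (@thead _ _) xpredT) //=.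
apply: eq_bigr => i _; rewrite -sum1_card.
rewrite (reindex (fun t : n.-tuple 'I_N => [tuple of i :: t])) /=.
  apply: eq_bigl => t; rewrite !inE theadE eqxx andbT /=.
  by rewrite cat_rcons.
exists (fun t : n.+1.-tuple 'I_N => behead_tuple t) => t /=.
  by move=> _; apply: val_inj.
by rewrite inE => /andP[_ /eqP <-]; rewrite -tuple_eta.
Qed.

Lemma extensions_invalid (tau : seq nat) (N n : nat) (w : seq nat) :
  size tau > 0 -> ~~ valid tau w -> extensions tau N n w = 0.
Proof.
move=> tau0; elim: n w => [|n IHn] w invalid_w.
  by rewrite extensions0 (negPf invalid_w).
rewrite extensionsS big1 // => i _; apply: IHn.
by apply: contraNN invalid_w; apply: valid_rcons.
Qed.

Lemma bnum_extensions (tau : seq nat) (n : nat) :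
  bnum tau n = extensions tau n n [::].
Proof. by []. Qed.

(** * Transitions between the states of a prefix *)

(* [m] is the maximum, [s] the slack, and [z] tells whether the last term is 0;
   when [m = 0] the flag [z] carries no information. *)
Definition state (tau w : seq nat) (m s : nat) (z : bool) : Prop :=
  [/\ valid tau w, m \in w, all (leq^~ m) w, last 0 w = (if z then 0 else m)
    & asc w = m + s].

Lemma state_neq0 (tau w : seq nat) (m s : nat) (z : bool) :
  state tau w m s z -> w != [::].
Proof. by case: w => // -[]. Qed.

Lemma valid_head (tau w : seq nat) : valid tau w -> head 0 w = 0.
Proof.
case: w => // x w /and3P[/ascent_seqP/(_ 0 isT)/eqP x0 _ _]; exact: x0.
Qed.

(** Being at least the maximum, [y] ends no occurrence of 021 or [tau]; the upper bound on [y] is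
    [(asc w).+1]. *)
Lemma valid_rcons_max (tau w : seq nat) (m s y : nat) (z : bool) :
  has (ltn (last 0 tau)) tau -> state tau w m s z -> m <= y <= m + s.+1 ->
  valid tau (rcons w y).
Proof.
move=> tau_max st /andP[le_my le_y]; have w0 := state_neq0 st.
case: st => /and3P[asc_w av1 av2] _ w_le_m _ ascE.
have w_le_y : all (leq^~ y) w.
  by apply: sub_all w_le_m => x /= le_xm; apply: leq_trans le_my.
apply/and3P; split.
- by rewrite ascent_seq_rcons // asc_w ascE -addnS.
- by apply: contraNN av1; apply: contains_rcons_max.
- by apply: contraNN av2; apply: contains_rcons_max.
Qed.

(** The last letter of 021 is not its smallest, so an appended 0 ends no occurrence of 021. *)
Lemma state_zero (tau w : seq nat) (m s : nat) (z : bool) :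
  state tau w m s z -> avoids (rcons w 0) tau ->
  state tau (rcons w 0) m s true.
Proof.
move=> st av; have w0 := state_neq0 st.
case: st => /and3P[asc_w av1 av2] mw w_le_m _ ascE; split.
- apply/and3P; split=> //; first by rewrite ascent_seq_rcons // asc_w.
  apply: contraNN av1 => /containsP[u]; elim/last_ind: u => [|u x _] sub_u.
    by case/same_orderP.
  move=> order_u; move: sub_u; rewrite subseq_rcons_rcons => /orP[?|/andP[/eqP zy uw]].
    by apply/containsP; exists (rcons u x).
  have [/eqP] := same_orderP _ _ order_u.
  rewrite size_rcons eqSS => /eqP size_u /(_ 0 2 isT isT).
  by rewrite !nth_rcons size_u /= zy.
- by rewrite mem_rcons inE mw orbT.
- by rewrite all_rcons leq0n.
- by rewrite last_rcons.
- by rewrite asc_rcons // ltn0 addn0.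
Qed.

(** After a 0 the term [m] adds an ascent but keeps the maximum, so the slack grows by 1; after [m]
    it adds no ascent. *)
Lemma state_max (tau w : seq nat) (m s : nat) (z : bool) :
  has (ltn (last 0 tau)) tau -> 0 < m -> state tau w m s z ->
  state tau (rcons w m) m (s + z) false.
Proof.
move=> tau_max m0 st; have w0 := state_neq0 st.
have val_m : valid tau (rcons w m).
  by apply: valid_rcons_max st _; rewrite // leqnn leq_addr.
case: st => _ mw w_le_m lastE ascE; split => //.
- by rewrite mem_rcons inE eqxx.
- by rewrite all_rcons leqnn.
- by rewrite last_rcons.
- by rewrite asc_rcons // ascE lastE addnA; case: z {lastE}; rewrite ?m0 ?ltnn.
Qed.

(** The new term is indexed by the slack [i] that it leaves: it always creates an ascent, which
    makes [m + s.+1] of them. *)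
Lemma state_larger (tau w : seq nat) (m s i : nat) (z : bool) :
  has (ltn (last 0 tau)) tau -> state tau w m s z -> i <= s ->
  state tau (rcons w (m + s.+1 - i)) (m + s.+1 - i) i false.
Proof.
move=> tau_max st le_is; have w0 := state_neq0 st.
have lt_m : m < m + s.+1 - i by lia.
have val_m : valid tau (rcons w (m + s.+1 - i)).
  by apply: valid_rcons_max st _; rewrite // (ltnW lt_m) leq_subr.
case: st => _ mw w_le_m lastE ascE; split => //.
- by rewrite mem_rcons inE eqxx.
- rewrite all_rcons leqnn /=; apply: sub_all w_le_m => x /= le_xm.
  exact: leq_trans (ltnW lt_m).
- by rewrite last_rcons.
- rewrite asc_rcons // ascE lastE.
  have -> : (if z then 0 else m) < m + s.+1 - i by case: z {lastE}; lia.
  lia.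
Qed.

(** A term strictly between 0 and [m] forms 021 with the initial 0 and [m]; one above [m + s.+1]
    breaks the ascent bound. *)
Lemma invalid_rcons (tau w : seq nat) (m s y : nat) (z : bool) :
  state tau w m s z -> 0 < y < m \/ m + s.+1 < y -> ~~ valid tau (rcons w y).
Proof.
move=> st; have w0 := state_neq0 st.
case: st => val_w mw _ _ ascE [/andP[y0 ltym]|lt_y]; last first.
  by rewrite /valid ascent_seq_rcons // ascE leqNgt -addnS lt_y andbF.
suff cont : contains (rcons w y) [:: 0; 2; 1].
  by rewrite /valid /avoids cont andbF.
have := valid_head val_w; case: w w0 mw {ascE val_w} => //= x w _ mw x0.
apply/containsP; exists [:: x; m; y].
  rewrite /= eqxx (subseq_rcons_rcons [:: m]) eqxx sub1seq.
  move: mw; rewrite inE x0 => /predU1P[m0|->]; last by rewrite orbT.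
  by rewrite m0 in ltym.
rewrite x0 /same_order /= y0 (ltn_trans y0 ltym) ltym !ltnn.
by rewrite [m < y]ltnNge (ltnW ltym).
Qed.

(** The factor [(0 < m)] avoids counting the term 0 twice. Since [m + s] grows by at most 1 per
    term, the bound on [N] is preserved along the continuation. *)
Lemma extensions_step (tau w : seq nat) (m s N n : nat) (z : bool) :
  has (ltn (last 0 tau)) tau -> state tau w m s z -> m + s.+1 + n < N ->
  extensions tau N n.+1 w =
    extensions tau N n (rcons w 0) + (0 < m) * extensions tau N n (rcons w m) +
    \sum_(i < s.+1) extensions tau N n (rcons w (m + s.+1 - i)).
Proof.
move=> tau_max st ltN; have tau0 : 0 < size tau by case: tau tau_max {st}.
pose g i := extensions tau N n (rcons w i).
have g0 i : 0 < i < m \/ m + s.+1 < i -> g i = 0.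
  by move=> i_bad; apply: extensions_invalid => //; apply: invalid_rcons st i_bad.
rewrite extensionsS -(big_mkord xpredT g) -/(g 0) -/(g m).
rewrite (@big_cat_nat _ _ _ (m + s.+1).+1) //=; last lia.
rewrite [X in _ + X]big_nat_cond [X in _ + X]big1 ?addn0; last first.
  by move=> i; rewrite andbT => /andP[lt_i _]; apply: g0; right.
rewrite (@big_cat_nat _ _ _ m.+1) //=; last lia.
congr (_ + _).
  rewrite big_nat_recl //; case: m st ltN g0 => [|m] st ltN g0.
    by rewrite big_geq.
  rewrite big_nat_recr //= mul1n big_nat_cond big1 // => i.
  by rewrite andbT => /andP[_ lt_i]; apply: g0; left.
rewrite -[m.+1]add0n big_addn (_ : (m + s.+1).+1 - m.+1 = s.+1); last lia.
(* Reversing the sum turns the distance above [m.+1] into the remaining slack. *)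
rewrite big_mkord (reindex_inj rev_ord_inj) /=; apply: eq_bigr => i _.
rewrite /g; congr (extensions _ _ _ (rcons _ _)).
have := ltn_ord i; lia.
Qed.

(** Used with [x] = 0: once 0 is forbidden, it stays forbidden after any further term. *)
Lemma contains_rcons_insert (tau w : seq nat) (x y : nat) :
  contains (rcons w x) tau -> contains (rcons (rcons w y) x) tau.
Proof.
case/containsP=> u uw u_tau; apply/containsP; exists u => //.
by apply: subseq_trans uw _; rewrite subseq_rcons_rcons eqxx subseq_rcons orbT.
Qed.

(* Counts the continuations, by [n] terms from slack [s], of a prefix after which
   0 is forbidden. *)
Fixpoint count_closed (n s : nat) : nat :=
  if n is n'.+1
  then count_closed n' s + \sum_(i < s.+1) count_closed n' i
  else 1.

(** With 0 forbidden the last term stays positive, so repeating [m] keeps the slack, and a larger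
    term leaves any slack up to [s]. *)
Lemma extensions_closed (tau w : seq nat) (m s N n : nat) :
  has (ltn (last 0 tau)) tau -> 0 < m -> state tau w m s false ->
  contains (rcons w 0) tau -> m + s + n < N ->
  extensions tau N n w = count_closed n s.
Proof.
move=> tau_max; have tau0 : 0 < size tau by case: tau tau_max.
elim: n w m s => [|n IHn] w m s m0 st closed ltN.
  by rewrite extensions0; case: st => ->.
rewrite (extensions_step tau_max st) ?m0 ?mul1n //; last lia.
rewrite extensions_invalid //; last by rewrite /valid /avoids closed !andbF.
have stm := state_max tau_max m0 st; rewrite addn0 in stm.
rewrite (IHn _ m s) //; [| exact: contains_rcons_insert | lia].
congr (_ + _); apply: eq_bigr => i _; have := ltn_ord i; rewrite ltnS => le_is.
apply: IHn (state_larger tau_max st le_is) _ _; try lia.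
exact: contains_rcons_insert.
Qed.

(** * Leading zeros and the first nonzero term *)

Lemma avoids_nseq (tau : seq nat) (x j : nat) :
  has (ltn (last 0 tau)) tau -> avoids (nseq j x) tau.
Proof.
move=> tau_max; elim: j => [|j]; first by rewrite avoids_longer //; case: tau tau_max.
apply: contraNN; have -> : nseq j.+1 x = rcons (nseq j x) x.
  by elim: j => //= j <-.
by apply: contains_rcons_max; rewrite // all_nseq leqnn orbT.
Qed.

Lemma state_nseq (tau : seq nat) (j : nat) :
  has (ltn (last 0 tau)) tau -> state tau (nseq j.+1 0) 0 0 true.
Proof.
move=> tau_max; elim: j => [|j IHj].
  split=> //; last by rewrite /asc eq_card0 // => -[].
  apply/and3P; split; [by apply/ascent_seqP => -[] | exact: avoids_longer |].
  exact: (avoids_nseq 0 1 tau_max).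
have nseq_rcons : nseq j.+2 0 = rcons (nseq j.+1 0) 0.
  by elim: j {IHj} => // j; rewrite -[nseq j.+3 0]/(0 :: nseq j.+2 0) => {1}->.
rewrite nseq_rcons; apply: state_zero IHj _.
by rewrite -nseq_rcons avoids_nseq.
Qed.

(** A valid sequence is either all zeros, which accounts for the successor, or has 1 as its first
    nonzero term, as no ascent precedes it; [i] is the number of terms after that 1. *)
Lemma bnum_init (tau : seq nat) (f : nat -> nat) (n : nat) :
  has (ltn (last 0 tau)) tau ->
  (forall N i j, i.+1 < N ->
    extensions tau N i (rcons (nseq j.+1 0) 1) = f i) ->
  bnum tau n.+1 = (\sum_(i < n) f i).+1.
Proof.
move=> tau_max ext_f; have tau0 : 0 < size tau by case: tau tau_max {ext_f}.
have ext_nseq k N j : k < N ->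
    extensions tau N k (nseq j.+1 0) = (\sum_(i < k) f i).+1.
  elim: k j => [|k IHk] j ltk; have st := state_nseq j tau_max.
    by rewrite extensions0 big_ord0; case: st => ->.
  rewrite (extensions_step tau_max st) // mul0n addn0 big_ord1 subn0 add0n.
  rewrite ext_f // big_ord_recr /= -addSn -(IHk j.+1) ?(ltnW ltk) //.
  by congr (extensions _ _ _ _ + _); elim: j {IHk st} => //= j ->.
rewrite bnum_extensions extensionsS big_ord_recl /= big1 ?addn0.
  exact: (ext_nseq _ _ 0).
move=> i _; apply: extensions_invalid => //.
by apply/negP => /valid_head.
Qed.

Lemma notin_max (m y : nat) (w : seq nat) :
  all (leq^~ m) w -> m < y -> y \notin w.
Proof. by move=> /allP w_le ltmy; apply/negP => /w_le /=; rewrite leqNgt ltmy. Qed.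

(** * The pattern 1010 *)

Definition open1010 (w : seq nat) : Prop :=
  forall x, 0 < x -> ~~ subseq [:: x; 0; x] w.

(** In a copy of 1010 ending in the new 0 the second term equals that 0, so the first three terms
    form x 0 x. *)
Lemma avoids1010_zero (w : seq nat) :
  avoids w [:: 1; 0; 1; 0] -> open1010 w -> avoids (rcons w 0) [:: 1; 0; 1; 0].
Proof.
move=> av op; apply: contraNN av => /containsP[u]; elim/last_ind: u => [|u d _] sub_u.
  by case/same_orderP.
move=> order_u; move: sub_u; rewrite subseq_rcons_rcons => /orP[?|/andP[/eqP d0 uw]].
  by apply/containsP; exists (rcons u d).
have [] := same_orderP _ _ order_u; rewrite {}d0 size_rcons.
case: u uw {order_u} => [|a [|b [|c [|? ?]]]] //= uw _ lt_u.
have a0 := lt_u 3 0 isT isT; have b0 := lt_u 3 1 isT isT.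
have ac := lt_u 0 2 isT isT; have ca := lt_u 2 0 isT isT.
rewrite /= in a0 b0 ac ca.
have eq_ac : a = c by lia.
have eq_b : b = 0 by lia.
by move: uw; rewrite eq_b -eq_ac (negPf (op a a0)).
Qed.

Lemma open1010_zero (w : seq nat) : open1010 w -> open1010 (rcons w 0).
Proof.
move=> op x x0; rewrite (subseq_rcons_rcons [:: x; 0]) (negPf (op x x0)) /=.
by rewrite gtn_eqF.
Qed.

Lemma open1010_larger (w : seq nat) (m y : nat) :
  all (leq^~ m) w -> m < y -> open1010 w -> open1010 (rcons w y).
Proof.
move=> w_le ltmy op x x0; rewrite (subseq_rcons_rcons [:: x; 0]) (negPf (op x x0)) /=.
apply/negP=> /andP[/eqP -> /mem_subseq/(_ y)]; rewrite inE eqxx => /(_ isT).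
exact/negP/(notin_max w_le).
Qed.

(** An x 0 x ending at the new [m] could end at the preceding [m] instead, as [m] is not 0. *)
Lemma open1010_max (w : seq nat) (m : nat) :
  last 0 w = m -> 0 < m -> open1010 w -> open1010 (rcons w m).
Proof.
case/lastP: w => [|w y]; rewrite ?last_rcons => <-; rewrite // => m0 op x x0.
rewrite (subseq_rcons_rcons [:: x; 0]) (negPf (op x x0)) /= (subseq_rcons_rcons [:: x]).
rewrite (ltn_eqF m0) orbF; apply/negP=> /andP[/eqP x_m sub_m].
by move: (op x x0); rewrite (subseq_rcons_rcons [:: x; 0]) x_m eqxx -x_m sub_m orbT.
Qed.

(* The slack is 0 as long as 0 is allowed: appending the maximum after a 0, the
   only step that increases the slack, creates x 0 x. *)
Fixpoint count_open (n : nat) (z : bool) : nat :=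
  if n is n'.+1
  then count_open n' true +
    (if z then count_closed n' 1 else count_open n' false) +
    count_open n' false
  else 1.

Lemma extensions_open (w : seq nat) (m N n : nat) (z : bool) :
  let tau := [:: 1; 0; 1; 0] in
  0 < m -> state tau w m 0 z -> open1010 w -> m + n < N ->
  extensions tau N n w = count_open n z.
Proof.
move=> tau; elim: n w m z => [|n IHn] w m z m0 st op ltN.
  by rewrite extensions0; case: st => ->.
rewrite (extensions_step (erefl : has (ltn (last 0 tau)) tau) st); last lia.
rewrite m0 mul1n big_ord1 subn0 /=.
have av0 : avoids (rcons w 0) tau.
  by apply: avoids1010_zero op; case: st => /and3P[].
rewrite (IHn _ m true) //; [|exact: state_zero st av0|exact: open1010_zero|lia].
have stl := state_larger (erefl : has (ltn (last 0 tau)) tau) st (leqnn 0).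
rewrite subn0 in stl.
rewrite [X in _ + _ + X](IHn _ (m + 1) false) //; [|lia| |lia]; last first.
  by case: st => _ _ w_le _ _; apply: open1010_larger w_le _ op; rewrite addn1.
have stm := state_max (erefl : has (ltn (last 0 tau)) tau) m0 st.
congr (_ + _ + _); case: z st stm => st stm; last first.
  apply: IHn stm _ _ => //; last lia.
  by case: st => _ _ _ last_m _; apply: open1010_max.
apply: extensions_closed stm _ _ => //; last lia.
(* The word contains [m] and ends in 0; the appended [m] and 0 complete the copy. *)
apply/containsP; exists [:: m; 0; m; 0]; last first.
  by rewrite /same_order /= !ltnn m0.
rewrite (subseq_rcons_rcons [:: m; 0; m]) eqxx (subseq_rcons_rcons [:: m; 0]) eqxx /=.
case: st => _ + _ last0 _.
case/lastP: w {op av0 stl ltN} last0 => [|w y] //; rewrite last_rcons => ->.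
rewrite mem_rcons inE gtn_eqF // => /= mw.
by rewrite (subseq_rcons_rcons [:: m]) eqxx sub1seq mw !orbT.
Qed.

Lemma bnum1010 (n : nat) :
  bnum [:: 1; 0; 1; 0] n.+1 = (\sum_(i < n) count_open i false).+1.
Proof.
set tau := [:: _; _; _; _].
apply: (@bnum_init tau (count_open^~ false)) => // N i j lt_i.
have st := state_nseq (tau := tau) j isT.
have stl : state tau (rcons (nseq j.+1 0) 1) 1 0 false.
  exact: (state_larger (erefl : has (ltn (last 0 tau)) tau) st (leqnn 0)).
apply: extensions_open stl _ _ => //.
apply: (@open1010_larger _ 0) => //; first by rewrite all_nseq leqnn orbT.
move=> x x0; apply/negP => /mem_subseq/(_ x); rewrite inE eqxx => /(_ isT).
by rewrite mem_nseq gtn_eqF ?andbF.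
Qed.

(** * The pattern 1120 *)

(** As nonzero terms increase weakly, a repeated positive term below the maximum [m] is followed by
    a larger one and forbids 0. With [m.+1] for [m], the maximum is not repeated either. *)
Definition no_repeat_below (w : seq nat) (m : nat) : Prop :=
  forall x, 0 < x < m -> ~~ subseq [:: x; x] w.

Lemma no_repeat_below_rcons (w : seq nat) (m y : nat) :
  ~~ (0 < y < m) -> no_repeat_below w m -> no_repeat_below (rcons w y) m.
Proof.
move=> y_out norep x x_in; rewrite (subseq_rcons_rcons [:: x]) (negPf (norep x x_in)).
by apply: contra y_out => /andP[/eqP <-].
Qed.

Lemma no_repeat_below_larger (w : seq nat) (m y : nat) :
  all (leq^~ m) w -> m < y ->
  no_repeat_below w m.+1 -> no_repeat_below (rcons w y) y.+1.
Proof.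
move=> w_le ltmy norep x /andP[x0 _].
rewrite (subseq_rcons_rcons [:: x]) sub1seq negb_or.
have [-> | neq_xy] := eqVneq x y.
  have y_notin := notin_max w_le ltmy.
  by rewrite (contra _ y_notin) // => /mem_subseq; apply; rewrite inE eqxx.
rewrite andbT; have [le_xm | lt_mx] := leqP x m; first by apply: norep; rewrite x0.
apply/negP => /mem_subseq/(_ x); rewrite inE eqxx => /(_ isT).
exact/negP/(notin_max w_le).
Qed.

(** A copy of 1120 ending in the new 0 starts with a a c where 0 < a < c <= [m], so a is a repeated
    term below [m]. *)
Lemma avoids1120_zero (w : seq nat) (m : nat) :
  avoids w [:: 1; 1; 2; 0] -> all (leq^~ m) w -> no_repeat_below w m ->
  avoids (rcons w 0) [:: 1; 1; 2; 0].
Proof.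
move=> av /allP w_le norep; apply: contraNN av => /containsP[u].
elim/last_ind: u => [|u d _] sub_u; first by case/same_orderP.
move=> order_u; move: sub_u; rewrite subseq_rcons_rcons => /orP[?|/andP[/eqP d0 uw]].
  by apply/containsP; exists (rcons u d).
have [] := same_orderP _ _ order_u; rewrite {}d0 size_rcons.
case: u uw {order_u} => [|a [|b [|c [|? ?]]]] //= uw _ lt_u.
have a0 := lt_u 3 0 isT isT; have ac := lt_u 0 2 isT isT.
have ab := lt_u 0 1 isT isT; have ba := lt_u 1 0 isT isT.
rewrite /= in a0 ab ac ba.
have eq_ab : b = a by lia.
have cw : c \in w by apply: (mem_subseq uw); rewrite !inE eqxx !orbT.
have a_in : 0 < a < m by rewrite a0 (leq_trans ac) //; apply: w_le.
have /negP[] := norep a a_in; apply: subseq_trans uw.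
by rewrite eq_ab (prefix_subseq [:: a; a]).
Qed.

Lemma contains1120_zero (w : seq nat) (m y : nat) :
  0 < m < y -> subseq [:: m; m] w ->
  contains (rcons (rcons w y) 0) [:: 1; 1; 2; 0].
Proof.
move=> /andP[m0 lt_my] mm; apply/containsP; exists [:: m; m; y; 0].
  rewrite (subseq_rcons_rcons [:: m; m; y]) eqxx (subseq_rcons_rcons [:: m; m]) eqxx.
  by rewrite mm !orbT.
by rewrite /same_order /= !ltnn m0 lt_my (ltn_trans m0 lt_my) [y < m]ltnNge (ltnW lt_my).
Qed.

(* The only repeated nonzero term is the maximum; 0 is still allowed. *)
Fixpoint count_twice (n : nat) (z : bool) (s : nat) : nat :=
  if n is n'.+1
  then count_twice n' true s + count_twice n' false (s + z) +
    \sum_(i < s.+1) count_closed n' i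
  else 1.

(** Appending 0 or [m] keeps the repetition at the maximum; a larger term turns it into x x z and
    forbids 0 for good. *)
Lemma extensions_twice (w : seq nat) (m s N n : nat) (z : bool) :
  let tau := [:: 1; 1; 2; 0] in
  0 < m -> state tau w m s z -> no_repeat_below w m -> subseq [:: m; m] w ->
  m + s + n < N -> extensions tau N n w = count_twice n z s.
Proof.
move=> tau; elim: n w s z => [|n IHn] w s z m0 st norep rep ltN.
  by rewrite extensions0; case: st => ->.
have tau_max : has (ltn (last 0 tau)) tau by [].
rewrite (extensions_step tau_max st); last lia.
rewrite m0 mul1n /=.
have av0 : avoids (rcons w 0) tau.
  by case: st => /and3P[_ _ ?] _ w_le _ _; apply: avoids1120_zero w_le norep.
congr (_ + _ + _).
- apply: IHn (state_zero st av0) _ _ _ => //; last lia.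
    exact: no_repeat_below_rcons.
  exact: subseq_trans rep (subseq_rcons _ _).
- apply: IHn (state_max tau_max m0 st) _ _ _ => //.
  + by apply: no_repeat_below_rcons => //; rewrite ltnn andbF.
  + exact: subseq_trans rep (subseq_rcons _ _).
  + by case: (z); lia.
- apply: eq_bigr => i _; have := ltn_ord i; rewrite ltnS => le_is.
  apply: extensions_closed (state_larger tau_max st le_is) _ _ => //; try lia.
  by apply: contains1120_zero rep; lia.
Qed.

(* The nonzero terms are distinct; the slack is then 0. *)
Fixpoint count_once (n : nat) (z : bool) : nat :=
  if n is n'.+1
  then count_once n' true + count_twice n' false z + count_once n' false
  else 1.

(** Only repeating [m] leaves this class, with slack 1 if the preceding term is 0 and slack 0
    otherwise. *)
Lemma extensions_once (w : seq nat) (m N n : nat) (z : bool) :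
  let tau := [:: 1; 1; 2; 0] in
  0 < m -> state tau w m 0 z -> no_repeat_below w m.+1 -> m + n < N ->
  extensions tau N n w = count_once n z.
Proof.
move=> tau; elim: n w m z => [|n IHn] w m z m0 st norep ltN.
  by rewrite extensions0; case: st => ->.
have tau_max : has (ltn (last 0 tau)) tau by [].
have norep' : no_repeat_below w m.
  by move=> x /andP[x0 lt_x]; apply: norep; rewrite x0 ltnW.
rewrite (extensions_step tau_max st); last lia.
rewrite m0 mul1n big_ord1 subn0 /=.
have av0 : avoids (rcons w 0) tau.
  by case: st => /and3P[_ _ ?] _ w_le _ _; apply: avoids1120_zero w_le norep'.
congr (_ + _ + _).
- apply: IHn (state_zero st av0) _ _ => //; last lia.
  exact: no_repeat_below_rcons.
- apply: extensions_twice (state_max tau_max m0 st) _ _ _ => //.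
  + by apply: no_repeat_below_rcons => //; rewrite ltnn andbF.
  + by rewrite (subseq_rcons_rcons [:: m]) eqxx sub1seq; case: st => _ -> *; rewrite orbT.
  + by case: (z); lia.
- have stl := state_larger tau_max st (leqnn 0); rewrite subn0 in stl.
  apply: IHn stl _ _; try lia.
  case: st => _ _ w_le _ _; apply: no_repeat_below_larger w_le _ norep.
  by rewrite addn1.
Qed.

Lemma bnum1120 (n : nat) :
  bnum [:: 1; 1; 2; 0] n.+1 = (\sum_(i < n) count_once i false).+1.
Proof.
set tau := [:: _; _; _; _].
apply: (@bnum_init tau (count_once^~ false)) => // N i j lt_i.
have st := state_nseq (tau := tau) j isT.
have stl : state tau (rcons (nseq j.+1 0) 1) 1 0 false.
  exact: (state_larger (erefl : has (ltn (last 0 tau)) tau) st (leqnn 0)).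
apply: extensions_once stl _ _ => //.
apply: (@no_repeat_below_larger _ 0) => //; first by rewrite all_nseq leqnn orbT.
by move=> [].
Qed.

(** * Linear recurrences *)

(** The two sums at [n.+1] differ by [count_closed n.+1 s.+1], which by definition is twice the sum
    at [n] up to [s.+1] minus the one up to [s]. *)
Lemma count_closed_sum (n s : nat) :
  \sum_(i < s.+2) count_closed n.+1 i + \sum_(i < s.+1) count_closed n i =
  \sum_(i < s.+1) count_closed n.+1 i + 2 * \sum_(i < s.+2) count_closed n i.
Proof.
have closedE t : count_closed n.+1 t =
  count_closed n t + \sum_(i < t.+1) count_closed n i by [].
have sumS (f : nat -> nat) : \sum_(i < s.+2) f i = \sum_(i < s.+1) f i + f s.+1.
  by rewrite big_ord_recr.
rewrite !sumS closedE [in LHS]sumS.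
set p := count_closed n s.+1.
set q := \sum_(i < s.+1) count_closed n i; lia.
Qed.

(* The coefficient form of (1 - 2x) T_(s+1) = (1 - x) T_s. *)
Lemma count_twice_slack (n s : nat) (z : bool) :
  count_twice n.+1 z s.+1 + count_twice n z s =
  count_twice n.+1 z s + 2 * count_twice n z s.+1.
Proof.
elim: n s z => [|n IHn] s z.
  by rewrite /= !sum1_card !card_ord; lia.
have twiceE k t y : count_twice k.+1 y t = count_twice k true t +
    count_twice k false (t + y) + \sum_(i < t.+1) count_closed k i by [].
(* The relation is linear, so it suffices to have it for each of the three summands. *)
have := IHn s true; have := IHn (s + z) false; have := count_closed_sum n s.
rewrite !(twiceE _ s.+1 z) !(twiceE _ s z) addSn; lia.
Qed.

(** The denominator expands to 1 - 7x + 17x^2 - 16x^3 + 4x^4; negative terms are moved across to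
    stay in [nat]. Here [u n] stands for [bnum tau n.+1]. *)
Definition recurrence (u : nat -> nat) : Prop :=
  [/\ u 0 = 1, u 1 = 2, u 2 = 5, u 3 = 14 &
   forall n, u n.+4 + 17 * u n.+2 + 4 * u n = 7 * u n.+3 + 16 * u n.+1].

Lemma recurrence1010 : recurrence (fun n => (\sum_(i < n) count_open i false).+1).
Proof.
set u := fun n => _.
have uS n : u n.+1 = u n + count_open n false.
  by rewrite /u big_ord_recr.
have u0 : u 0 = 1 by rewrite /u big_ord0.
have p1S n : count_closed n.+1 1 = 2 * count_closed n 1 + count_closed n 0.
  by rewrite /= big_ord_recr big_ord1 /=; lia.
have p0S n : count_closed n.+1 0 = 2 * count_closed n 0.
  by rewrite /= big_ord1 mul2n addnn.
have oS n : count_open n.+1 false =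
    count_open n true + count_open n false + count_open n false by [].
have zS n : count_open n.+1 true =
    count_open n true + count_closed n 1 + count_open n false by [].
(* The transfer matrix also has eigenvalue 1; by this relation the corresponding
   component vanishes, so that a recurrence of order 4 suffices. *)
have inv n : u n + count_closed n 1 = count_open n true + count_closed n 0.
  elim: n => [|n IHn]; first by rewrite u0.
  by rewrite uS p1S p0S zS; lia.
have o0 : count_open 0 false = 1 by [].
have z0 : count_open 0 true = 1 by [].
have c00 : count_closed 0 0 = 1 by [].
have c01 : count_closed 0 1 = 1 by [].
split=> [||||n]; rewrite ?(uS, oS, zS, p1S, p0S, u0, o0, z0, c00, c01) //.
by have := inv n; lia.
Qed.

Lemma recurrence1120 : recurrence (fun n => (\sum_(i < n) count_once i false).+1).
Proof.
set u := fun n => _.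
have uS n : u n.+1 = u n + count_once n false.
  by rewrite /u big_ord_recr.
have u0 : u 0 = 1 by rewrite /u big_ord0.
have qS n : count_closed n.+1 0 = 2 * count_closed n 0.
  by rewrite /= big_ord1 mul2n addnn.
have aS n : count_twice n.+1 false 0 =
    count_twice n true 0 + count_twice n false 0 + count_closed n 0.
  by rewrite /= big_ord1.
have bS n : count_twice n.+1 true 0 =
    count_twice n true 0 + count_twice n false 1 + count_closed n 0.
  by rewrite /= big_ord1.
(* Unfolding alone would involve ever larger slacks; the slack relation closes the system. *)
have cS n : count_twice n.+1 false 1 =
    count_twice n true 0 + count_closed n 0 + 2 * count_twice n false 1.
  by have := count_twice_slack n 0 false; rewrite aS; lia.
have oS n : count_once n.+1 false =
    count_once n true + count_twice n false 0 + count_once n false by [].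
have zS n : count_once n.+1 true =
    count_once n true + count_twice n false 1 + count_once n false by [].
(* The system has seven unknowns; these relations leave four. *)
have inv n : [/\ count_twice n false 1 + count_closed n 0 =
      count_twice n false 0 + count_twice n true 0,
    count_once n true + count_closed n 0 = u n + count_twice n true 0 &
    count_once n false + count_twice n true 0 =
      count_once n true + count_twice n false 0].
  elim: n => [|n [IH1 IH2 IH3]]; first by rewrite u0.
  by rewrite uS qS aS bS cS oS zS; split; lia.
have o0 z : count_once 0 z = 1 by [].
have t0 z s : count_twice 0 z s = 1 by [].
have c0 : count_closed 0 0 = 1 by [].
split=> [||||n]; rewrite ?(uS, oS, zS, aS, bS, cS, qS, u0, o0, t0, c0) //.
by have [? ? ?] := inv n; lia.
Qed.

Local Open Scope ring_scope.

(** * Generating functions *)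

Lemma fps_mulC (F : fieldType) (u v : fps F) : fps_mul u v =1 fps_mul v u.
Proof.
move=> n; rewrite /fps_mul (reindex_inj rev_ord_inj) /=; apply: eq_bigr => i _.
by rewrite subSS subKn 1?mulrC // -ltnS.
Qed.

(** Coefficient [n] of a product depends only on coefficients up to [n], so associativity can be
    carried over from polynomials by truncation. *)
Lemma fps_mul_poly (F : fieldType) (u v : fps F) (p q : {poly F}) (n : nat) :
  (forall i, (i <= n)%N -> u i = p`_i) -> (forall i, (i <= n)%N -> v i = q`_i) ->
  fps_mul u v n = (p * q)`_n.
Proof.
move=> up vq; rewrite coefM; apply: eq_bigr => i _.
have le_in : (i <= n)%N by rewrite -ltnS.
by rewrite up // vq // leq_subr.
Qed.

Lemma fps_mulA (F : fieldType) (u v w : fps F) :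
  fps_mul u (fps_mul v w) =1 fps_mul (fps_mul u v) w.
Proof.
move=> n; pose trunc (x : fps F) := \poly_(i < n.+1) x i.
have truncE x i : (i <= n)%N -> x i = (trunc x)`_i.
  by move=> le_in; rewrite coef_poly ltnS le_in.
rewrite (@fps_mul_poly _ _ _ (trunc u) (trunc v * trunc w)); last 2 first.
- exact: truncE.
- move=> i le_in; apply: fps_mul_poly => j le_ji; apply: truncE;
  exact: leq_trans le_in.
rewrite mulrA; apply/esym/fps_mul_poly; last exact: truncE.
move=> i le_in; apply: fps_mul_poly => j le_ji; apply: truncE;
  exact: leq_trans le_in.
Qed.

Lemma fps_mulr1 (F : fieldType) (u : fps F) : fps_mul u (fps_of_poly 1) =1 u.
Proof.
move=> n; rewrite /fps_mul big_ord_recr /= subnn /fps_of_poly coef1 mulr1.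
rewrite big1 ?add0r // => i _.
by rewrite coef1 subn_eq0 leqNgt ltn_ord mulr0.
Qed.

Lemma fps_div_unique (F : fieldType) (u v g : fps F) :
  v 0%N != 0 -> fps_mul g v =1 u -> g =1 fps_div u v.
Proof.
move=> v0 gv n; rewrite /fps_div.
have -> : fps_mul u (fps_inv v) n = fps_mul (fps_mul g v) (fps_inv v) n.
  by apply: eq_bigr => i _; rewrite gv.
rewrite -fps_mulA -[LHS]fps_mulr1; apply: eq_bigr => i _; congr (_ * _).
by rewrite fps_mulC fps_mulVf.
Qed.

Lemma gf_recurrence (tau : seq nat) (u : nat -> nat) :
  has (ltn (last 0%N tau)) tau ->
  (forall n, bnum tau n.+1 = u n) -> recurrence u ->
  gf tau =1
    fps_div
      (fps_of_poly ((1 - 'X) * (1 - 5 *: 'X + 7 *: 'X^2 - 'X^3)))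
      (fps_of_poly ((1 - 2 *: 'X) ^+ 2 * (1 - 3 *: 'X + 'X^2))).
Proof.
move=> tau_max bS [u0 u1 u2 u3 uS].
have b0 : bnum tau 0 = 1%N.
  rewrite bnum_extensions extensions0 /valid !avoids_longer // ?andbT.
    by case: ascent_seqP => // -[].
  by case: (tau) tau_max.
have -> : (1 - 'X) * (1 - 5 *: 'X + 7 *: 'X^2 - 'X^3) =
    Poly [:: 1; -6%:R; 12%:R; -8%:R; 1] :> {poly rat}.
  rewrite /= !cons_poly_def -!mul_polyC; ring.
have -> : (1 - 2 *: 'X) ^+ 2 * (1 - 3 *: 'X + 'X^2) =
    Poly [:: 1; -7%:R; 17%:R; -16%:R; 4%:R] :> {poly rat}.
  rewrite /= !cons_poly_def -!mul_polyC; ring.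
apply: fps_div_unique => [|n]; first by rewrite /fps_of_poly coef_Poly.
rewrite fps_mulC /fps_mul /fps_of_poly.
under eq_bigr do rewrite coef_Poly.
rewrite coef_Poly /gf.
(* Degrees 0 to 4 are checked on the initial values; from degree 5 on the numerator has coefficient
   0 and the recurrence applies. *)
case: n => [|[|[|[|[|n]]]]]; rewrite ?big_ord_recl ?big_ord0 /= ?(b0, bS, u0, u1, u2, u3).
1-5: ring.
rewrite mul0r add0r big1 => [|i _]; last by rewrite mul0r.
have /(congr1 (GRing.natmul (1 : rat))) := uS n.
rewrite 2![in X in X = _]natrD [in X in _ = X]natrD !natrM nth_nil addr0 => uSn; lra.
Qed.

Theorem theorem2p8 (tau : seq nat)
  (htau : tau = [:: 1; 0; 1; 0]%N \/ tau = [:: 1; 1; 2; 0]%N) :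
  gf tau =1
    fps_div
      (fps_of_poly ((1 - 'X) * (1 - 5 *: 'X + 7 *: 'X^2 - 'X^3)))
      (fps_of_poly ((1 - 2 *: 'X) ^+ 2 * (1 - 3 *: 'X + 'X^2))).
Proof.
case: htau => ->.
- by apply: gf_recurrence bnum1010 recurrence1010.
- by apply: gf_recurrence bnum1120 recurrence1120.
Qed.
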